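(* Let $(E,\mathcal E,\mu)=(\mathbb R^d,\mathfrak B(\mathbb R^d),\mu)$, where $\mu$ is an outer regular measure. Then $(\widetilde{\mathcal E}_{fin},d_\mu)$ is separable.
   Context: $d$ is a positive integer and $\mathfrak B(\mathbb R^d)$ is the Borel $\sigma$-algebra. A measure $\mu$ on $(\mathbb R^d,\mathfrak B(\mathbb R^d))$ (possibly infinite, not assumed $\sigma$-finite) is outer regular if $\mu(A)=\inf\{\mu(U):U\text{ open},\ A\subseteq U\}$ for each $A\in\mathfrak B(\mathbb R^d)$. For $A\in\mathcal E$ let $[A]=\{B\in\mathcal E:\mu(A\Delta B)=0\}$, where $\Delta$ is symmetric difference, $\widetilde{\mathcal E}=\{[A]:A\in\mathcal E\}$ and $\widetilde{\mathcal E}_{fin}=\{[A]:A\in\mathcal E,\ \mu(A)<\infty\}$. The metric is $d_\mu([A],[B])=\mu(A\Delta B)^{1/2}$. *)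

(* Defs.v *)
From HB Require Import structures.
From mathcomp Require Import all_boot all_order all_algebra.
From mathcomp Require Import all_classical all_reals all_analysis.

Set Implicit Arguments.
Unset Strict Implicit.
Unset Printing Implicit Defensive.

Import Order.TTheory GRing.Theory Num.Theory.
Import numFieldNormedType.Exports.

Local Open Scope classical_set_scope.
Local Open Scope ring_scope.

(* [A `+` B] is the symmetric difference of sets. *)

Section measure_algebra.
Context {disp : measure_display} {T : measurableType disp} {R : realType}.
Variable mu : {measure set T -> \bar R}.

Definition mclass (A : set T) : set (set T) :=
  [set B | measurable B /\ mu (A `+` B) = 0%E].

Definition fin_mclasses : set (set (set T)) :=
  [set mclass A | A in [set A | measurable A /\ (mu A < +oo)%E]].

Definition fin_mclass_type : Type := set_type fin_mclasses.

HB.instance Definition _ := Choice.on fin_mclass_type.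

Definition to_fin_mclass (A : set T) (mA : measurable A) (fA : (mu A < +oo)%E) :
  fin_mclass_type := SigSub (mem_set (imageP mclass (conj mA fA))).

Lemma fin_mclass_ex (X : fin_mclass_type) :
  exists A, [/\ measurable A, (mu A < +oo)%E & \val X = mclass A].
Proof. by case: X => X /= /set_mem [A [mA fA] <-]; exists A. Qed.

Definition mrepr (X : fin_mclass_type) : set T := sval (cid (fin_mclass_ex X)).

(* The distance is computed on arbitrary representatives; it does not depend
   on their choice, see [mclass_distE]. *)
Definition mclass_dist (X Y : fin_mclass_type) : R :=
  Num.sqrt (fine (mu (mrepr X `+` mrepr Y))).

Lemma measurable_setY (A B : set T) :
  measurable A -> measurable B -> measurable (A `+` B).
Proof. by move=> mA mB; apply: measurableU; apply: measurableD. Qed.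

Lemma measure_setY_triangle (A B C : set T) :
  measurable A -> measurable B -> measurable C ->
  (mu (A `+` C) <= mu (A `+` B) + mu (B `+` C))%E.
Proof.
move=> mA mB mC.
have mAB := measurable_setY mA mB; have mBC := measurable_setY mB mC.
have mAC := measurable_setY mA mC.
apply: le_trans (measureU2 _ mAB mBC).
apply: le_measure; rewrite ?inE //; first exact: measurableU.
by move=> x /=; have [Bx|Bx] := pselect (B x); tauto.
Qed.

Lemma measure_setY_lty (A B : set T) :
  measurable A -> measurable B -> (mu A < +oo)%E -> (mu B < +oo)%E ->
  (mu (A `+` B) < +oo)%E.
Proof.
move=> mA mB fA fB; apply: (@le_lt_trans _ _ (mu A + mu B)%E).
  apply: le_trans (measureU2 _ mA mB).
  apply: le_measure; rewrite ?inE //.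
  - exact: measurable_setY.
  - exact: measurableU.
  - by move=> x /=; tauto.
by rewrite lte_add_pinfty.
Qed.

Lemma mclass_eqP (A B : set T) : measurable A -> measurable B ->
  mclass A = mclass B <-> mu (A `+` B) = 0%E.
Proof.
move=> mA mB; split=> [AB|AB0].
  have : mclass B B by split=> //; rewrite setYK measure0.
  by rewrite -AB => -[].
have sub A' B' : measurable A' -> measurable B' -> mu (A' `+` B') = 0%E ->
    mclass A' `<=` mclass B'.
  move=> mA' mB' AB' C [mC AC]; split=> //; apply/eqP.
  rewrite eq_le measure_ge0 andbT.
  apply: le_trans (measure_setY_triangle mB' mA' mC) _.
  by rewrite AC adde0 setYC AB'.
by apply/seteqP; split; apply: sub => //; rewrite setYC.
Qed.

Lemma mreprP (X : fin_mclass_type) :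
  [/\ measurable (mrepr X), (mu (mrepr X) < +oo)%E
    & \val X = mclass (mrepr X)].
Proof. by rewrite /mrepr; case: cid. Qed.

Lemma mclass_distE (A B : set T) (mA : measurable A) (mB : measurable B)
    (fA : (mu A < +oo)%E) (fB : (mu B < +oo)%E) :
  mclass_dist (to_fin_mclass mA fA) (to_fin_mclass mB fB) =
  Num.sqrt (fine (mu (A `+` B))).
Proof.
rewrite /mclass_dist.
have [mX fX /= /(mclass_eqP mA mX) AX] := mreprP (to_fin_mclass mA fA).
have [mY fY /= /(mclass_eqP mB mY) BY] := mreprP (to_fin_mclass mB fB).
set X := mrepr _ in mX fX AX *; set Y := mrepr _ in mY fY BY *.
congr (Num.sqrt (fine _)); apply/eqP; rewrite eq_le; apply/andP; split.
- apply: le_trans (measure_setY_triangle mX mA mY) _.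
  rewrite setYC AX add0e.
  by apply: le_trans (measure_setY_triangle mA mB mY) _; rewrite BY adde0.
- apply: le_trans (measure_setY_triangle mA mX mB) _.
  rewrite AX add0e.
  apply: le_trans (measure_setY_triangle mX mY mB) _.
  by rewrite [Y `+` B]setYC BY adde0.
Qed.

Lemma mclass_distxx X : mclass_dist X X = 0.
Proof. by rewrite /mclass_dist setYK measure0 sqrtr0. Qed.

Lemma mclass_dist_sym X Y : mclass_dist X Y = mclass_dist Y X.
Proof. by rewrite /mclass_dist setYC. Qed.

Lemma mclass_dist_fin X Y : mu (mrepr X `+` mrepr Y) \is a fin_num.
Proof.
have [mX fX _] := mreprP X; have [mY fY _] := mreprP Y.
by rewrite ge0_fin_numE ?measure_ge0 // measure_setY_lty.
Qed.

Lemma mclass_dist_eq0 X Y : mclass_dist X Y = 0 -> X = Y.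
Proof.
have [mX fX eX] := mreprP X; have [mY fY eY] := mreprP Y.
move=> /eqP; rewrite sqrtr_eq0 => le0; apply: val_inj; rewrite eX eY.
apply/mclass_eqP => //; apply/eqP; rewrite eq_le measure_ge0 andbT.
by rewrite -(fineK (mclass_dist_fin X Y)) lee_fin.
Qed.

Lemma mclass_dist_triangle Y X Z :
  mclass_dist X Z <= mclass_dist X Y + mclass_dist Y Z.
Proof.
have [mX _ _] := mreprP X; have [mY _ _] := mreprP Y.
have [mZ _ _] := mreprP Z.
have := measure_setY_triangle mX mY mZ.
rewrite /mclass_dist -(fineK (mclass_dist_fin X Y)).
rewrite -(fineK (mclass_dist_fin Y Z)) -(fineK (mclass_dist_fin X Z)).
rewrite -EFinD lee_fin /=.
set a := fine _; set b := fine _; set c := fine _ => abc.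
have b0 : 0 <= b by rewrite fine_ge0.
have c0 : 0 <= c by rewrite fine_ge0.
rewrite -(@ler_pXn2r _ 2) ?nnegrE ?addr_ge0 ?sqrtr_ge0 //.
rewrite sqr_sqrtr ?fine_ge0 // sqrrD !sqr_sqrtr //.
apply: le_trans abc _; rewrite -addrA lerD2l lerDr.
by rewrite mulrn_wge0 // mulr_ge0 ?sqrtr_ge0.
Qed.

HB.instance Definition _ := isMetric.Build R fin_mclass_type
  mclass_distxx mclass_dist_eq0 mclass_dist_sym mclass_dist_triangle.

End measure_algebra.

Definition separable (S : topologicalType) : Prop :=
  exists2 D : set S, countable D & dense D.

(* R^n with its Borel sigma-algebra. The topology of ['rV[R]_n] is the product
   topology, that is, the Euclidean one. *)
Notation borel_space R n := (g_sigma_algebraType (@open 'rV[R]_n)).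

Definition outer_regular (R : realType) (n : nat)
    (mu : {measure set (borel_space R n) -> \bar R}) : Prop :=
  forall A : set (borel_space R n), measurable A ->
    mu A = ereal_inf [set mu U | U in
                       [set U : set 'rV[R]_n | open U /\ A `<=` U]].

(* Main.v *)
(* Rational balls give R^d a countable base. Given A of finite measure, outer
   regularity yields an open U containing A with mu U close to mu A, and U is
   the increasing union of finite unions of basic open sets, so by continuity
   of mu some finite union is close to U, hence to A. There are only countably
   many finite unions of basic open sets. *)
Require Import Defs.
From HB Require Import structures.
From mathcomp Require Import all_boot all_order all_algebra.
From mathcomp Require Import all_classical all_reals all_analysis.

Import Order.TTheory GRing.Theory Num.Theory.
Import numFieldNormedType.Exports.

Local Open Scope classical_set_scope.
Local Open Scope ring_scope.

(** The base consists of balls of radius [1/(n+1)] centred in [D]. Interiors are taken because a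
    pseudometric ball need not be open. *)
Lemma separable_second_countable (R : realType) (T : pseudoMetricType R) :
  separable T -> @second_countable T.
Proof.
move=> [D cD dD].
pose b (p : T * nat) : set T := (ball p.1 (p.2.+1%:R^-1 : R))°.
exists (b @` (D `*` setT)).
  apply: sub_countable (card_image_le _ _) _.
  exact: countableX.
split=> [_ [p _ <-]|x V /nbhs_ballP[_ /posnumP[e] xeV]].
  exact: open_interior.
have [//|n] := @ltr_add_invr R 0 (e%:num / 2) _; rewrite add0r => ne.
(* With [y] within half the radius of [x], the half-radius ball around [x] lies in the full ball
   around [y], so [x] is in its interior. *)
have n0 : (0 : R) < n.+1%:R^-1 / 2 by rewrite divr_gt0 ?invr_gt0.
have [y [xy Dy]] : (ball x (PosNum n0)%:num)° `&` D !=set0.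
  apply: dD; last exact: open_interior.
  by exists x; exact: nbhsx_ballx.
have {}yx : ball y (n.+1%:R^-1 / 2) x.
  by apply: ball_sym; exact: interior_subset xy.
exists (b (y, n)); first split.
- by exists (y, n).
- apply/nbhs_ballP; exists (n.+1%:R^-1 / 2) => //= z xz.
  by rewrite [_^-1]splitr; exact: ball_triangle xz.
- move=> z /interior_subset /= yz; apply: xeV.
  rewrite [e%:num]splitr; apply: (@ball_triangle _ _ y).
    apply: le_ball (ball_sym yx).
    by apply: le_trans (ltW ne); rewrite ler_pdivrMr// ler_peMr// ler1n.
  exact: le_ball (ltW ne) _ yz.
Qed.

(** A ball of row vectors constrains each entry separately, so rational approximations can be chosen
    entry by entry. *)
Lemma separable_rV (R : realType) (n : nat) : separable 'rV[R]_n.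
Proof.
exists (range (map_mx (@ratr R) : 'rV[rat]_n -> 'rV[R]_n)).
  exact: sub_countable (card_image_le _ _) _.
move=> O [x Ox]; rewrite openE => /(_ _ Ox)/nbhs_ballP[e /= e0 xeO].
have /choice[q xq] : forall j, exists q : rat, ball (x 0 j) e (ratr q).
  move=> j.
  have [|y [xy [q _ qy]]] := @dense_rat R _ _ (ball_open (x 0 j) e).
    by exists (x 0 j); exact: ballxx.
  by exists q; rewrite qy.
exists (map_mx ratr (\row_j q j)); split; last by exists (\row_j q j).
by apply: xeO; split=> // i j; rewrite !mxE ord1.
Qed.

(** [b n] is the union of the base members with code [n]: by injectivity of [f] at most one, and the
    empty set when [n] codes nothing. *)
Lemma second_countable_sequence (T : topologicalType) : @second_countable T ->
  exists b : nat -> set T, (forall n, open (b n)) /\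
    (forall U x, open U -> U x -> exists n, b n x /\ b n `<=` U).
Proof.
move=> [B /countable_injP[f finj] [Bo Bb]].
exists (fun n => \bigcup_(V in B `&` [set V | f V = n]) V); split=> [n|U x oU Ux].
  by apply: bigcup_open => V [/Bo oV _].
have [V [BV Vx] VU] : filter_from [set U | B U /\ U x] id U.
  by apply: Bb; exact: open_nbhs_nbhs.
exists (f V); split; first by exists V.
by move=> y [W [BW fWV]]; rewrite (finj W V) ?inE// => /VU.
Qed.

(** Continuity from above: the sets [U \ F n] have finite measure and decrease to the empty set. *)
Lemma measure_bigcupD_small (disp : measure_display) (T : measurableType disp)
    (R : realType) (mu : {measure set T -> \bar R}) (F : (set T)^nat) (e : R) :
  (forall n, measurable (F n)) -> nondecreasing_seq F ->
  (mu (\bigcup_n F n) < +oo)%E -> 0 < e ->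
  exists n, (mu (\bigcup_n F n `\` F n) < e%:E)%E.
Proof.
move=> mF ndF; set U := \bigcup_n F n => fU e0.
have mU : measurable U by exact: bigcupT_measurable.
have mD n : measurable (U `\` F n) by exact: measurableD.
have capD : \bigcap_n (U `\` F n) = set0.
  rewrite -subset0 => x xD; have [[n _ Fnx] _] := xD 0%N I.
  by have [_ /(_ Fnx)] := xD n I.
have : (mu (U `\` F n) @[n --> \oo] --> mu (\bigcap_n (U `\` F n)))%E.
  apply: nonincreasing_cvg_mu => //.
  - apply: le_lt_trans fU; apply: le_measure; rewrite ?inE//.
  - by rewrite capD.
  - move=> m n mn; apply/subsetPset; apply: setDS.
    by apply/subsetPset; exact: ndF.
rewrite capD measure0 => /(_ [set x | (x < e%:E)%E]) /=.
case=> [|N _ UFe].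
  apply: open_nbhs_nbhs; split; first exact: open_ereal_lt_ereal.
  by rewrite /= lte_fin.
by exists N; exact: (UFe N (leqnn N)).
Qed.

Theorem theorem3p3 (R : realType) (d : nat) (d_gt0 : (0 < d)%N)
  (mu : {measure set (borel_space R d) -> \bar R}) :
  outer_regular mu -> separable (fin_mclass_type mu).
Proof.
move=> mu_or.
have [b [bo bU]] := second_countable_sequence _
  (separable_second_countable R _ (separable_rV R d)).
pose V (s : seq nat) : set (borel_space R d) := \bigcup_(i in [set` s]) b i.
have mopen (U : set 'rV[R]_d) : open U -> measurable (U : set (borel_space R d)).
  exact: sub_sigma_algebra.
have mV s : measurable (V s) by apply: mopen; exact: bigcup_open.
(* Some [V s] may have infinite measure; the preimage under [\val] keeps only the classes of finite
   measure. *)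
exists (\val @^-1` range (mclass mu \o V)).
  have /countable_injP[f finj] : countable (range (mclass mu \o V)).
    exact: sub_countable (card_image_le _ _) _.
  apply/countable_injP; exists (f \o \val) => X Y; rewrite !inE => VX VY fXY.
  by apply: val_inj; apply: finj => //; rewrite inE.
move=> O [X OX]; rewrite openE => /(_ _ OX)/nbhs_ballP[e /= e0 XeO].
have [mA fA XA] := mreprP X; set A := mrepr X in mA fA XA.
(* The distance is the square root of a measure, so the total error allowed is [e ^+ 2]; half goes
   to [U \ A], half to [U \ F n]. *)
have e20 : 0 < e ^+ 2 / 2 by rewrite divr_gt0// exprn_gt0.
have Afin : mu A \is a fin_num by rewrite ge0_fin_numE.
have [_ [U [oU AU] <-] Ue] : exists2 u,
    [set mu U | U in [set U : set 'rV[R]_d | open U /\ A `<=` U]] u &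
    (u < mu A + (e ^+ 2 / 2)%:E)%E.
  by rewrite mu_or//; apply: lb_ereal_inf_adherent => //; rewrite -mu_or.
have mU := mopen _ oU.
have fU : (mu U < +oo)%E.
  by apply: lt_trans Ue _; rewrite lte_add_pinfty// ltry.
(* Among the first [n] basic sets, only those inside [U] are kept, so that [F n] increases to [U]
   from within. *)
pose F n := V [seq i <- iota 0 n | `[< b i `<=` U >]].
have UF : \bigcup_n F n = U.
  apply/seteqP; split=> [x [n _ [i /=]]|x Ux].
    by rewrite mem_filter => /andP[/asboolP biU _] /biU.
  have [i [bix biU]] := bU _ _ oU Ux.
  exists i.+1 => //; exists i => //; rewrite /mkset.
  by rewrite mem_filter mem_iota add0n ltnSn !andbT; exact/asboolP.
have ndF : nondecreasing_seq F.
  move=> m n mn; apply/subsetPset => x [i /= im bix]; exists i => //=.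
  move: im; rewrite !mem_filter !mem_iota !add0n => /andP[-> /=] im.
  exact: leq_trans im mn.
have [|n UFe] := measure_bigcupD_small _ _ _ mu F _ (fun n => mV _) ndF _ e20.
  by rewrite UF.
rewrite UF in UFe.
have FU : F n `<=` U by rewrite -UF; exact: bigcup_sup.
have fF : (mu (F n) < +oo)%E.
  by apply: le_lt_trans fU; apply: le_measure; rewrite ?inE//; exact: mV.
have UAe : (mu (U `\` A) < (e ^+ 2 / 2)%:E)%E.
  by rewrite measureD// (setIidr AU) lteBlDl.
(* Both [A] and [F n] lie in [U], so a point in just one of them is in [U] and misses the other. *)
have AFe : (mu (A `+` F n) < (e ^+ 2)%:E)%E.
  rewrite [e ^+ 2]splitr EFinD; apply: le_lt_trans (lteD UAe UFe).
  have mUA : measurable ((U : set (borel_space R d)) `\` A) by exact: measurableD.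
  have mUF : measurable ((U : set (borel_space R d)) `\` F n).
    by apply: measurableD => //; exact: mV.
  apply: le_trans (measureU2 _ mUA mUF).
  apply: le_measure; rewrite ?inE.
  - by apply: measurable_setY => //; exact: mV.
  - exact: measurableU.
  - by move=> x [[/AU Ux nFx]|[/FU Ux nAx]]; [right|left].
exists (to_fin_mclass (mV _) fF); split; last by eexists.
apply: XeO; rewrite ballEmdist /=.
have -> : X = to_fin_mclass mA fA by exact: val_inj.
rewrite [mdist _ _]mclass_distE -[e](ger0_norm (ltW e0)) -sqrtr_sqr.
rewrite ltr_sqrt ?exprn_gt0// -lte_fin fineK// ge0_fin_numE//.
exact: lt_trans AFe (ltry _).
Qed.
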